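(* There is no strongly optimal Dirichlet function on the Diophantine space $(\mathbb{R},\mathbb{Q},H_{\mathrm{std}})$. In particular, the Dirichlet function $\psi_2(q)=q^{-2}$ is not strongly optimal on $(\mathbb{R},\mathbb{Q},H_{\mathrm{std}})$.
   Context: $H_{\mathrm{std}}:\mathbb{Q}\to\mathbb{N}$ is the standard height function: $H_{\mathrm{std}}(p/q)=q$ when $p/q$ is in reduced form with $q\geq 1$; $\mathbb{R}$ carries the usual metric. A function $\psi:(0,+\infty)\to(0,+\infty)$ is a Dirichlet function on $(\mathbb{R},\mathbb{Q},H_{\mathrm{std}})$ if for every $x\in\mathbb{R}$ there exist $C_x>0$ and a sequence $(r_n)_{n\ge1}$ in $\mathbb{Q}$ such that $r_n\to x$ and $|x-r_n|\leq C_x\,\psi(H_{\mathrm{std}}(r_n))$ for all $n$. A Dirichlet function $\psi$ is strongly optimal if for every Dirichlet function $\phi:(0,+\infty)\to(0,+\infty)$ there exists $C>0$ such that $\psi\leq C\phi$ (pointwise on $(0,+\infty)$). *)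

(* Defs.v *)
From HB Require Import structures.
From mathcomp Require Import all_boot all_order all_algebra.
From mathcomp Require Import all_classical all_reals all_analysis.
Import Order.TTheory GRing.Theory Num.Theory numFieldNormedType.Exports.

Set Implicit Arguments.
Unset Strict Implicit.
Unset Printing Implicit Defensive.

Local Open Scope classical_set_scope.
Local Open Scope ring_scope.

Definition H_std (r : rat) : nat := `|denq r|%N.

Lemma H_std_gt0 (R : realType) (r : rat) : 0 < (H_std r)%:R :> R.
Proof. by rewrite ltr0n absz_gt0 denq_neq0. Qed.

(* {posnum R} is the open half-line (0, +oo); this is the height seen there. *)
Definition H_std_pos (R : realType) (r : rat) : {posnum R} :=
  PosNum (H_std_gt0 R r).

(* Sequences are indexed from 0 instead of 1. *)
Definition dirichlet (R : realType) (psi : {posnum R} -> {posnum R}) : Prop :=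
  forall x : R, exists C : R, 0 < C /\
    exists r : nat -> rat,
      (ratr (r n) : R) @[n --> \oo] --> x /\
      forall n, `|x - ratr (r n)| <= C * (psi (H_std_pos R (r n)))%:num.

Definition strongly_optimal (R : realType) (psi : {posnum R} -> {posnum R}) : Prop :=
  dirichlet psi /\
  forall phi : {posnum R} -> {posnum R}, dirichlet phi ->
    exists C : R, 0 < C /\ forall t : {posnum R}, (psi t)%:num <= C * (phi t)%:num.

Definition psi2 (R : realType) (q : {posnum R}) : {posnum R} :=
  (q%:num ^- 2)%:pos.

(* Main.v *)
Require Import Defs.
From HB Require Import structures.
From mathcomp Require Import all_boot all_order all_algebra.
From mathcomp Require Import all_classical all_reals all_analysis.
From mathcomp Require Import ring lra.
Import Order.TTheory GRing.Theory Num.Theory numFieldNormedType.Exports.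

(** Every real number has good rational approximations inside a very thin set
of heights, so a Dirichlet function may be tiny at all the others.  Given a
prime [p], rounding [p ^ n.+1 * x] to an integer prime to [p] yields a reduced
fraction of height exactly [p ^ n.+1] within [1 / p ^ n.+1] of [x]
([prime_power_approx]).  Hence a function equal to [1 / t] on the powers of
[p] is Dirichlet whatever its values elsewhere; [slow_on] takes [1 / t ^ 3]
outside a chosen set ([dirichlet_slow_on]).

Let [A] be the set of powers of 2.  Both [slow_on A] and [slow_on (~` A)] are
Dirichlet, thanks to the primes 2 and 3, while at each [t] one of them is
[1 / t ^ 3].  A strongly optimal function would be dominated by both, hence by
a multiple of [1 / t ^ 3].  No Dirichlet function is that small
([not_dirichlet_cubic]): [Num.sqrt 2] stays at distance at least a constant
over [q ^ 2] from the fractions of height [q] ([sqrt2_badly_approximable]).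

That [1 / t ^ 2] is Dirichlet is Dirichlet's approximation theorem, proved by
the pigeonhole principle ([dirichlet_approximation]). *)

Local Open Scope classical_set_scope.
Local Open Scope ring_scope.

(** A sequence obeying the bound of a Dirichlet function need not come with a
rate of convergence; asking for distance [1 / n.+1] at step [n] is a
convenient way to get convergence, here with the constant [C] equal to 1. *)
Lemma dirichlet_of_approx (R : realType) (psi : {posnum R} -> {posnum R}) :
  (forall (x : R) (n : nat), exists r : rat,
     `|x - ratr r| <= n.+1%:R^-1 /\
     `|x - ratr r| <= (psi (H_std_pos R r))%:num) ->
  dirichlet psi.
Proof.
move=> approx x; exists 1; split=> //.
have [r rP] := choice (approx x).
exists r; split=> [|n]; last by rewrite mul1r; case: (rP n).
apply/cvgrPdist_le => e e0.
near=> n; have [/le_trans + _] := rP n; apply; apply: ltW.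
by near: n; exact: (near_infty_natSinv_lt (PosNum e0)).
Unshelve. all: by end_near. Qed.

Lemma ratr_frac (R : realType) (a b : int) :
  ratr (a%:~R / b%:~R) = a%:~R / b%:~R :> R.
Proof. by rewrite fmorph_div /= !ratr_int. Qed.

Lemma H_std_frac_le (m : int) (q : nat) :
  (0 < q)%N -> (H_std (m%:~R / q%:~R) <= q)%N.
Proof.
move=> q0; rewrite /H_std -(fracqE (m, q%:Z)) den_fracq /=.
by case: ifP => // _; exact: leq_div.
Qed.

(** Pigeonhole: the [n.+2] fractional parts of [0, x, ..., n.+1 * x] fall into
the [n.+1] boxes of width [1 / n.+1], so two of them share a box; the
difference of their indices is the denominator. *)
Lemma dirichlet_approximation (R : realType) (x : R) (n : nat) :
  exists m : int, exists q : nat,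
    (0 < q <= n.+1)%N /\ `|q%:R * x - m%:~R| <= n.+1%:R^-1.
Proof.
pose fr (k : nat) : R := k%:R * x - (Num.floor (k%:R * x))%:~R.
have fr_itv k : 0 <= fr k < 1.
  have /andP[lo hi] := floor_itv (k%:R * x).
  by rewrite /fr subr_ge0 lo ltrBlDl -intrD1.
have n0 : 0 < n.+1%:R :> R by rewrite ltr0n.
have fr_ge0 k : 0 <= n.+1%:R * fr k.
  by have /andP[? _] := fr_itv k; rewrite mulr_ge0 // ltW.
have box_lt k : (Num.truncn (n.+1%:R * fr k)%R < n.+1)%N.
  rewrite truncn_lt_nat //; have /andP[_ ?] := fr_itv k.
  by rewrite gtr_pMr.
(* [box_lt] is where the strict bound [fr k < 1] matters: it keeps the last box
   index at most [n]. *)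
pose box (k : 'I_n.+2) : 'I_n.+1 := Ordinal (box_lt k).
have [i [j [ij eqb]]] : exists i j : 'I_n.+2, (i < j)%N /\ box i = box j.
  have /injectivePn[i [j neq eqb]] : ~~ injectiveb box.
    by apply/injectiveP => /leq_card; rewrite !card_ord ltnn.
  case: (ltngtP i j) => [ij|ji|/val_inj e]; [by exists i, j|by exists j, i|].
  by rewrite e eqxx in neq.
exists (Num.floor (j%:R * x) - Num.floor (i%:R * x)), (j - i)%N; split.
  rewrite subn_gt0 ij /=; apply: leq_trans (leq_subr _ _) _.
  by rewrite -ltnS.
have -> : (j - i)%:R * x - (Num.floor (j%:R * x) - Num.floor (i%:R * x))%:~R
          = fr j - fr i :> R.
  by rewrite /fr natrB ?(ltnW ij) // intrB; ring.
rewrite -[leRHS]mul1r ler_pdivlMr // -{1}(gtr0_norm n0) -normrM mulrC mulrBr.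
have /andP[+ +] := truncn_itv (fr_ge0 i).
have /andP[+ +] := truncn_itv (fr_ge0 j).
have -> : Num.truncn (n.+1%:R * fr j) = Num.truncn (n.+1%:R * fr i).
  by have [->] := eqb.
by rewrite ler_norml -natr1; lra.
Qed.

(** The fraction [m / q] supplied by the approximation theorem may be reducible,
but cancelling only lowers the height, which weakens the bound to be met.
Rational [x] needs no separate treatment. *)
Lemma dirichlet_psi2 (R : realType) : dirichlet (@psi2 R).
Proof.
apply: dirichlet_of_approx => x n.
have [m [q [/andP[q0 qn]]]] := dirichlet_approximation R x n => bnd.
pose r : rat := m%:~R / q%:~R; exists r.
have Hq := H_std_frac_le m q q0; have H0 := H_std_gt0 R r.
have q0R : 0 < q%:R :> R by rewrite ltr0n.
have dist : `|x - ratr r| <= (q%:R * n.+1%:R)^-1.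
  rewrite /r ratr_frac -[q%:~R]/(q%:R) invfM -ler_pdivrMl ?invr_gt0 // invrK.
  by rewrite -{1}(gtr0_norm q0R) -normrM mulrBr mulrCA divff ?mulr1 // gt_eqF.
split; apply: le_trans dist _.
  by rewrite lef_pV2 ?posrE ?mulr_gt0 ?ltr0n // ler_peMl ?ler1n.
rewrite /= lef_pV2 ?posrE ?exprn_gt0 ?mulr_gt0 ?H0 ?ltr0n // expr2.
by rewrite -!natrM ler_nat leq_mul // (leq_trans Hq).
Qed.

(** Of the two integers around [x * p ^ n.+1] at most one is divisible by [p];
the other is the numerator of a reduced fraction, so that the height is the
full [p ^ n.+1]. *)
Lemma prime_power_approx (R : realType) (p : nat) (x : R) (n : nat) :
  prime p -> exists r : rat,
    H_std r = (p ^ n.+1)%N /\ `|x - ratr r| <= (p ^ n.+1)%:R^-1.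
Proof.
move=> pp; set q := (p ^ n.+1)%N.
have q0 : (0 < q)%N by rewrite expn_gt0 prime_gt0.
have q0R : 0 < q%:R :> R by rewrite ltr0n.
pose m := Num.floor (x * q%:R).
have [a [aP a_near]] : exists a : int,
    coprime `|a| p /\ `|x * q%:R - a%:~R| <= 1.
  have /andP[lo hi] := floor_itv (x * q%:R); rewrite -/m intrD1 in lo hi.
  case: (boolP (p%:Z %| m)%Z) => pm.
    exists (m + 1); split; last by rewrite intrD1 ler_norml; lra.
    rewrite coprime_sym prime_coprime //.
    apply/negP => pm1.
    have : (p%:Z %| (m + 1) - m)%Z by rewrite rpredB.
    by rewrite addrAC subrr add0r dvdzE /= dvdn1 gtn_eqF // prime_gt1.
  exists m; split; last by rewrite ler_norml; lra.
  by rewrite coprime_sym prime_coprime.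
exists (a%:~R / q%:~R); split.
  rewrite /H_std coprimeq_den; last by rewrite coprimeXr.
  by rewrite ifN // eqz_nat -lt0n.
rewrite ratr_frac -[q%:~R]/(q%:R) -[leRHS]mul1r ler_pdivlMr //.
by rewrite -{2}(gtr0_norm q0R) -normrM mulrBl divfK // gt_eqF.
Qed.

(** The exponent 3 serves only because it exceeds 2, the exponent
beyond which [Num.sqrt 2] cannot be approximated. *)
Definition slow_on (R : realType) (A : set {posnum R}) (t : {posnum R}) :
    {posnum R} :=
  if `[< A t >] then (t%:num^-1)%:pos else (t%:num ^- 3)%:pos.

Lemma dirichlet_slow_on (R : realType) (A : set {posnum R}) (p : nat) :
  prime p -> (forall (t : {posnum R}) n, t%:num = (p ^ n.+1)%:R -> A t) ->
  dirichlet (slow_on R A).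
Proof.
move=> pp powA; apply: dirichlet_of_approx => x n.
have [r [Hr xr]] := prime_power_approx R p x n pp; exists r; split.
  apply: le_trans xr _; rewrite lef_pV2 ?posrE ?ltr0n ?expn_gt0 ?(prime_gt0 pp) //.
  by rewrite ler_nat ltnW // ltn_expl // prime_gt1.
rewrite /slow_on asboolT /= ?Hr //.
by apply: (powA _ n); rewrite /= Hr.
Qed.

(** The irrationality of the square root of 2: the 2-adic valuation is odd on
the left and even on the right. *)
Lemma double_sqr_neq_sqr (a b : nat) : (0 < b)%N -> (2 * b ^ 2 != a ^ 2)%N.
Proof.
move=> b0; apply/eqP => e.
have := congr1 (fun k => odd (logn 2 k)) e.
by rewrite lognM ?expn_gt0 ?b0 // !lognX /= oddD !oddM.
Qed.

(** Liouville's argument: with [r = p / q], the product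
[(Num.sqrt 2 - r) * (Num.sqrt 2 + r)] is a nonzero integer over [q ^ 2], and
its second factor is at most 4 because [r] is within 1 of [Num.sqrt 2], which
is at most 3/2. *)
Lemma sqrt2_badly_approximable (R : realType) (r : rat) :
  `|Num.sqrt (2 : R) - ratr r| <= 1 ->
  (H_std r)%:R ^- 2 <= 4 * `|Num.sqrt (2 : R) - ratr r|.
Proof.
set s : R := Num.sqrt 2 => near_s.
have s0 : 0 <= s by exact: sqrtr_ge0.
have s2 : s ^+ 2 = 2 by rewrite sqr_sqrtr.
have s_le : s <= 3 / 2 by nra.
set q : R := (H_std r)%:R; have q0 : 0 < q := H_std_gt0 R r.
have rE : ratr r = (numq r)%:~R / q.
  have qE : q = (denq r)%:~R by rewrite /q /H_std -absz_denq.
  by rewrite -[in LHS](divq_num_den r) ratr_frac qE.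
have int_ge1 : 1 <= `|2 * q ^+ 2 - (numq r)%:~R ^+ 2|.
  have -> : 2 * q ^+ 2 - (numq r)%:~R ^+ 2
     = (2 * (H_std r)%:Z ^+ 2 - (numq r) ^+ 2)%:~R :> R.
    by rewrite intrB intrM !rmorphXn.
  rewrite -intr_norm ler1z -gtz0_ge1 normr_gt0 subr_eq0.
  apply/eqP => /(congr1 absz); rewrite abszM !abszX /= => /eqP.
  by apply/negP/double_sqr_neq_sqr; rewrite absz_gt0 denq_neq0.
have factor : q ^- 2 <= `|(s - ratr r) * (s + ratr r)|.
  have -> : (s - ratr r) * (s + ratr r)
      = (2 * q ^+ 2 - (numq r)%:~R ^+ 2) / q ^+ 2.
    by rewrite rE -s2; field; rewrite gt_eqF.
  have q2 : 0 <= q ^- 2 by rewrite invr_ge0 exprn_ge0 // ltW.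
  by rewrite normrM (ger0_norm q2) ler_peMl.
apply: le_trans factor _; rewrite normrM mulrC ler_wpM2r //.
by move: near_s; rewrite !ler_norml; lra.
Qed.

(** Comparing the lower bound in [1 / q ^ 2] with an upper bound in [1 / q ^ 3]
bounds the heights of all approximations of [Num.sqrt 2]; but then the lower
bound keeps them away from [Num.sqrt 2]. *)
Lemma not_dirichlet_cubic (R : realType) (psi : {posnum R} -> {posnum R})
    (C : R) :
  0 < C ->
  (forall t : {posnum R}, (psi t)%:num <= C * t%:num ^- 3) ->
  ~ dirichlet psi.
Proof.
move=> C0 psiC /(_ (Num.sqrt 2))[D [D0 [r [cvr bnd]]]].
set s : R := Num.sqrt 2 in cvr bnd.
pose B := 4 * (D * C).
have B0 : 0 < B by rewrite !mulr_gt0.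
have H_le n : `|s - ratr (r n)| <= 1 -> (H_std (r n))%:R <= B.
  move=> /sqrt2_badly_approximable; rewrite -/s.
  set q : R := (H_std (r n))%:R => low.
  have q0 : 0 < q := H_std_gt0 R (r n).
  have : q ^- 2 <= B * q ^- 3.
    apply: le_trans low _; rewrite /B -!mulrA ler_wpM2l //.
    by apply: le_trans (bnd n) _; rewrite ler_pM2l // psiC.
  have -> : q ^- 2 = q * q ^- 3 by field; rewrite gt_eqF.
  by rewrite ler_pM2r // invr_gt0 exprn_gt0.
(* Heights are at most [B], hence distances at least [B ^- 2 / 4]; half of this
   contradicts convergence, and the 1 makes [sqrt2_badly_approximable] apply. *)
pose e : R := Num.min 1 (B ^- 2 / 8).
have e0 : 0 < e by rewrite lt_min ltr01 divr_gt0 // invr_gt0 exprn_gt0.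
have /cvgrPdist_lt/(_ _ e0)[N _ /(_ N (leqnn N)) /=] := cvr.
rewrite lt_min => /andP[d1 d2].
have HB := H_le _ (ltW d1); have H0 := H_std_gt0 R (r N).
have low := sqrt2_badly_approximable R (r N) (ltW d1).
have : B ^- 2 <= (H_std (r N))%:R ^- 2.
  by rewrite lef_pV2 ?posrE ?exprn_gt0 // lerXn2r ?nnegrE // ltW.
have : 0 < B ^- 2 by rewrite invr_gt0 exprn_gt0.
by rewrite -/s in low; lra.
Qed.

(** The contradiction is reached at integer heights: the comparison functions
are large on complementary sets of heights, each of which suffices to
approximate every real number. *)
Lemma no_strongly_optimal (R : realType) (psi : {posnum R} -> {posnum R}) :
  ~ strongly_optimal psi.
Proof.
move=> [dpsi opt].
pose A : set {posnum R} := [set t | exists n, t%:num = (2 ^ n.+1)%:R].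
have [C1 [C10 psi1]] : exists C : R, 0 < C /\
    forall t, (psi t)%:num <= C * (slow_on R A t)%:num.
  by apply/opt/(dirichlet_slow_on R A 2) => // t n tE; exists n.
have [C2 [C20 psi2]] : exists C : R, 0 < C /\
    forall t, (psi t)%:num <= C * (slow_on R (~` A) t)%:num.
  apply/opt/(dirichlet_slow_on R (~` A) 3) => // t n tE [m].
  rewrite tE => /eqP; rewrite eqr_nat => /eqP /(congr1 odd).
  by rewrite !oddX.
apply: (@not_dirichlet_cubic R psi (Num.max C1 C2)) dpsi.
  by rewrite lt_max C10.
move=> t; have t0 : 0 <= t%:num ^- 3 by [].
have [At|nAt] := pselect (A t).
  have := psi2 t; rewrite /slow_on asboolF => [/le_trans|]; last exact.
  by apply; rewrite ler_wpM2r // le_max lexx orbT.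
have := psi1 t; rewrite /slow_on asboolF // => /le_trans; apply.
by rewrite ler_wpM2r // le_max lexx.
Qed.

Theorem proposition2p3 (R : realType) :
  (~ exists psi : {posnum R} -> {posnum R}, strongly_optimal psi) /\
  (dirichlet (@psi2 R) /\ ~ strongly_optimal (@psi2 R)).
Proof.
split; first by move=> [psi]; exact: no_strongly_optimal.
by split; [exact: dirichlet_psi2|exact: no_strongly_optimal].
Qed.
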